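(* Let $G=(V,E)$ be a graph with $n\geq 2$ vertices, and let $D$ and $D'$ be double-flip equivalence classes of $\mathrm{Acyc}(G)$ that are contained in the same flip equivalence class of $\mathrm{Acyc}(G)$. Then there exists $m\in\{0,\ldots,n-1\}$ such that the map $\tau_1\tau_2\cdots\tau_m c^m$ restricts to a bijection from $\mathcal L(D)$ to $\mathcal L(D')$ that commutes with $\mathrm{TPro}$, i.e., $(\tau_1\cdots\tau_m c^m)\,\mathrm{TPro}(\sigma)=\mathrm{TPro}\,(\tau_1\cdots\tau_m c^m)(\sigma)$ for all $\sigma\in\mathcal L(D)$. (When $m=0$ the map is the identity.)
   Context: All graphs are finite and simple. Let $G=(V,E)$ be a graph with $n$ vertices and $[n]=\{1,\ldots,n\}$. A labeling of $G$ is a bijection $V\to[n]$; $\Lambda_G$ is the set of all labelings of $G$. For distinct $i,j\in[n]$, let $(i\;j)\in S_n$ be the transposition swapping $i$ and $j$. The toggle operator $\tau_{i,j}\colon\Lambda_G\to\Lambda_G$ is defined by $\tau_{i,j}(\sigma)=(i\;j)\circ\sigma$ if $\{\sigma^{-1}(i),\sigma^{-1}(j)\}\notin E$, and $\tau_{i,j}(\sigma)=\sigma$ otherwise. Write $\tau_i=\tau_{i,i+1}$ for $i\in[n-1]$ and $\tau_n=\tau_{n,1}$. Toric promotion is $\mathrm{TPro}=\tau_n\tau_{n-1}\cdots\tau_2\tau_1\colon\Lambda_G\to\Lambda_G$. The operator $c\colon\Lambda_G\to\Lambda_G$ is $c(\sigma)=c\circ\sigma$, where on the right $c$ is the long cycle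 $(1\;2\;3\cdots n)\in S_n$ (so $c$ increases every label by $1$ modulo $n$). All products are compositions of maps, with the rightmost factor applied first. $\mathrm{Acyc}(G)$ is the set of acyclic orientations of $G$. A labeling $\sigma\in\Lambda_G$ induces $\alpha_\sigma\in\mathrm{Acyc}(G)$ by orienting each edge from the vertex with the smaller label to the vertex with the larger label. For $A\subseteq\mathrm{Acyc}(G)$, the set of linear extensions of $A$ is $\mathcal L(A)=\{\sigma\in\Lambda_G:\alpha_\sigma\in A\}$. A source is a vertex of in-degree $0$ and a sink is a vertex of out-degree $0$. A flip of an acyclic orientation reverses all edges incident to a source (making it a sink) or all edges incident to a sink (making it a source). Two acyclic orientations are flip equivalent if one can be obtained from the other by a sequence of flips. If $\alpha\in\mathrm{Acyc}(G)$ has a source $u$ and a sink $v$ with $u\neq v$ and $\{u,v\}\notin E$, then simultaneously flipping $u$ into a sink and $v$ into a source is called a double flip. Two acyclic orientations are double-flip equivalent if one can be obtained from the other by a sequence of double flips. Double-flip equivalence refines flip equivalence. *)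

(* Defs.v *)
From HB Require Import structures.
From mathcomp Require Import all_boot all_fingroup.

Set Implicit Arguments.
Unset Strict Implicit.
Unset Printing Implicit Defensive.

Record sgraph := SGraph {
  vertex :> finType;
  edge : rel vertex;
  edge_sym : symmetric edge;
  edge_irr : irreflexive edge
}.

(* Labels are 0-based: the label k + 1 of [n] is the element k of 'I_n, where  *)
(* n = #|G|.  Thus ordS, the cyclic successor of 'I_n, sends the label n to 1. *)
Notation label G := 'I_#|vertex G|.

Record labeling (G : sgraph) := Labeling {
  lab_fun :> {ffun G -> label G};
  lab_bij : injectiveb lab_fun && [forall i, i \in codom lab_fun]
}.
HB.instance Definition _ G := [isSub for @lab_fun G].
HB.instance Definition _ G := [Finite of labeling G by <:].

Section Labelings.
Variable G : sgraph.
Implicit Types (sigma : labeling G) (i j : label G).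

Lemma lab_inj sigma : injective sigma.
Proof. by have /andP[/injectiveP] := lab_bij sigma. Qed.

Lemma lab_surj sigma i : i \in codom sigma.
Proof. by have /andP[_ /forallP] := lab_bij sigma. Qed.

Definition lab_inv sigma i : G := iinv (lab_surj sigma i).

Lemma lab_invK sigma : cancel (lab_inv sigma) sigma.
Proof. by move=> i; apply: f_iinv. Qed.

Lemma relabel_subproof (s : {perm label G}) sigma (f := [ffun x => s (sigma x)]) :
  injectiveb f && [forall i, i \in codom f].
Proof.
apply/andP; split.
  by apply/injectiveP => x y; rewrite !ffunE => /perm_inj/lab_inj.
apply/forallP => i; apply/codomP; exists (lab_inv sigma (s^-1%g i)).
by rewrite ffunE lab_invK permKV.
Qed.

(* the labeling s \o sigma *)
Definition relabel (s : {perm label G}) sigma : labeling G :=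
  Labeling (relabel_subproof s sigma).

Definition toggle i j sigma : labeling G :=
  if edge (lab_inv sigma i) (lab_inv sigma j) then sigma
  else relabel (tperm i j) sigma.

(* tau i is tau_{i,i+1}, and tau_{n,1} when i is the last label *)
Definition tau i : labeling G -> labeling G := toggle i (ordS i).

(* tau_prod [:: i1; ...; ik] is the composite tau_{i1} ... tau_{ik}, in which *)
(* tau_{ik} is applied first.                                                 *)
Definition tau_prod (s : seq (label G)) sigma : labeling G := foldr tau sigma s.

(* enum 'I_n is increasing: this is tau_n ... tau_2 tau_1 *)
Definition TPro : labeling G -> labeling G := tau_prod (rev (enum (label G))).

Definition long_cycle : {perm label G} := perm (@ordS_inj #|G|).

Definition cyc : labeling G -> labeling G := relabel long_cycle.

(* tau_1 tau_2 ... tau_m c^m *)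
Definition tau_cyc (m : nat) sigma : labeling G :=
  tau_prod (take m (enum (label G))) (iter m cyc sigma).

End Labelings.

Section Orientations.
Variable G : sgraph.
Implicit Types (A : {set G * G}) (U : {set G}) (u v : G).

Definition arc A : rel G := [rel u v | (u, v) \in A].

Definition is_orientation A :=
  [forall u, forall v,
     if edge u v then ((u, v) \in A) (+) ((v, u) \in A) else (u, v) \notin A].

(* No arc u -> v is closed up by a directed path from v to u; see acyclicP. *)
Definition acyclic A :=
  [forall u, forall v, arc A u v ==> ~~ connect (arc A) v u].

Lemma acyclicP A :
  reflect (forall p : seq G, path.cycle (arc A) p -> p = [::]) (acyclic A).
Proof.
apply: (iffP forallP) => [acA [//|u p] | acA u].
  rewrite /= rcons_path => /andP[pathp arcl].
  have /forallP/(_ u)/implyP/(_ arcl) := acA (last u p).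
  by move=> /negP[]; apply/connectP; exists p.
apply/forallP => v; apply/implyP => uv; apply/negP => /connectP[p pathp def_u].
have := acA (v :: p).
by rewrite /= rcons_path pathp -def_u uv => /(_ isT).
Qed.

Definition in_degree A u := #|[set w | (w, u) \in A]|.
Definition out_degree A u := #|[set w | (u, w) \in A]|.
Definition source A u := in_degree A u == 0.
Definition sink A u := out_degree A u == 0.

Definition reverse_at U A : {set G * G} :=
  [set a | if (a.1 \in U) || (a.2 \in U) then (a.2, a.1) \in A else a \in A].

End Orientations.

Record acyc (G : sgraph) := Acyc {
  arcs :> {set G * G};
  arcsP : is_orientation arcs && acyclic arcs
}.
HB.instance Definition _ G := [isSub for @arcs G].
HB.instance Definition _ G := [Finite of acyc G by <:].

Section Acyc.
Variable G : sgraph.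
Implicit Types (sigma : labeling G) (alpha beta : acyc G).

Lemma induced_subproof sigma
    (A := [set a : G * G | edge a.1 a.2 && (sigma a.1 < sigma a.2)]) :
  is_orientation A && acyclic A.
Proof.
apply/andP; split; apply/forallP => u; apply/forallP => v.
  rewrite !inE /= (edge_sym v u); case: ifP => uv; rewrite uv //=.
  case: ltngtP => // /val_inj/lab_inj eq_uv.
  by rewrite eq_uv edge_irr in uv.
have arcE x y : arc A x y = edge x y && (sigma x < sigma y).
  by rewrite /arc /A /= inE.
apply/implyP; rewrite arcE => /andP[_ lt_uv].
apply/negP => /connectP[p pathp def_u].
suff: sigma v <= sigma u by rewrite leqNgt lt_uv.
rewrite {}def_u {lt_uv u}; elim: p v pathp => //= w p IHp v.
rewrite -/(arc A v w) arcE => /andP[/andP[_ /ltnW le_vw] /IHp].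
exact: leq_trans.
Qed.

Definition induced sigma : acyc G := Acyc (induced_subproof sigma).

(* Reversing the edges at sources and sinks keeps an orientation acyclic, so   *)
(* asking beta to be in acyc G in the next two relations excludes no flip.     *)
Definition flip : rel (acyc G) := fun alpha beta =>
  [exists u, (source alpha u || sink alpha u)
     && (arcs beta == reverse_at [set u] alpha)].

Definition double_flip : rel (acyc G) := fun alpha beta =>
  [exists u, exists v,
     [&& source alpha u, sink alpha v, u != v, ~~ edge u v
       & arcs beta == reverse_at [set u; v] alpha]].

(* The inverse of a (double) flip is a (double) flip, so these reflexive       *)
(* transitive closures are equivalence relations.                              *)
Definition flip_equiv : rel (acyc G) := connect flip.
Definition double_flip_equiv : rel (acyc G) := connect double_flip.

Definition flip_classes : {set {set acyc G}} :=
  equivalence_partition flip_equiv [set: acyc G].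
Definition double_flip_classes : {set {set acyc G}} :=
  equivalence_partition double_flip_equiv [set: acyc G].

Definition lin_ext (A : {set acyc G}) : {set labeling G} :=
  [set sigma | induced sigma \in A].

End Acyc.

(* Main.v *)
(* Put psi = tau_1 c. Since tau_(i+1) c = c tau_i, the map tau_1 ... tau_m c^m *)
(* is psi^m for m <= n, and psi^n = tau_1 ... tau_n is the inverse of TPro; so *)
(* every psi^m is injective and commutes with TPro. On induced orientations,   *)
(* psi flips the sink with label n. Up to double flips the result of flipping  *)
(* a sink depends neither on the sink nor on the representative, so psi acts   *)
(* on the double-flip classes; since flips are sink flips and their inverses,  *)
(* this action is transitive on each flip class. Every tau_i preserves the     *)
(* double-flip class, hence so does psi^n, and n steps suffice.                *)
Require Import Defs.
From mathcomp Require Import all_boot all_fingroup.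
From mathcomp Require Import zify.

Set Implicit Arguments.
Unset Strict Implicit.
Unset Printing Implicit Defensive.

(** By [tau_cyc_iter] everything is about powers of psi = tau_1 c, called [sink_step]. Since psi
    induces sink flips up to double flips, [sink_flip_congr] makes it act on double-flip classes
    ([sink_step_congr]), and [induced_surj] lets every flip be carried out on labelings. As psi^n
    consists of toggles, it fixes every class; so psi is invertible on classes by nonnegative
    powers, which handles source flips, and exponents matter only modulo n ([sink_step_flip_class]).
    The power found maps L(D) injectively into L(D'), another power maps L(D') injectively into
    L(D), and counting gives the bijection. *)

(** * Sink flips and double flips of acyclic orientations *)

Section OrientationTheory.
Variable G : sgraph.
Implicit Types (A : {set G * G}) (alpha beta gamma delta : acyc G).

Lemma sinkP A u : reflect (forall w, (u, w) \notin A) (sink A u).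
Proof.
rewrite /sink /out_degree cards_eq0; apply: (iffP eqP) => [A0 w|A0].
  by have /setP/(_ w) := A0; rewrite !inE => ->.
by apply/setP => w; rewrite !inE (negPf (A0 w)).
Qed.

Lemma sourceP A u : reflect (forall w, (w, u) \notin A) (source A u).
Proof.
rewrite /source /in_degree cards_eq0; apply: (iffP eqP) => [A0 w|A0].
  by have /setP/(_ w) := A0; rewrite !inE => ->.
by apply/setP => w; rewrite !inE (negPf (A0 w)).
Qed.

Lemma mem_reverse_at (V : {set G}) A x y :
  ((x, y) \in reverse_at V A) =
  if (x \in V) || (y \in V) then (y, x) \in A else (x, y) \in A.
Proof. by rewrite inE. Qed.

Lemma reverse_atK (V : {set G}) : involutive (reverse_at V).
Proof.
move=> A; apply/setP => -[x y]; rewrite !inE /= (orbC (y \in V)).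
by case: ifP => // ->.
Qed.

Lemma acyc_edgeE alpha u v :
  edge u v = ((u, v) \in arcs alpha) || ((v, u) \in arcs alpha).
Proof.
have /andP[/forallP orA _] := arcsP alpha.
have /forallP/(_ v) := orA u; have /forallP/(_ u) := orA v.
rewrite (edge_sym v u).
by case: ifP => _; case: (_ \in _); case: (_ \in _).
Qed.

(** After the flip no arc enters [v], so a directed cycle would avoid [v] and consist of arcs of
    [alpha]. *)
Lemma acyc_sink_flip_subproof alpha v : sink alpha v ->
  is_orientation (reverse_at [set v] alpha) && acyclic (reverse_at [set v] alpha).
Proof.
move=> /sinkP vS; have /andP[/forallP orA /forallP acA] := arcsP alpha.
apply/andP; split; apply/forallP => x; apply/forallP => y.
  rewrite !mem_reverse_at [(y \in _) || _]orbC.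
  have /forallP/(_ y) := orA x; have /forallP/(_ x) := orA y.
  by rewrite (edge_sym y x); case: ifP; case: ifP => //; rewrite addbC.
have nv z w : Defs.arc (reverse_at [set v] alpha) z w -> w != v.
  rewrite /Defs.arc /= mem_reverse_at !inE; case: (w =P v) => [->|//].
  by rewrite orbT (negPf (vS z)).
have arcE z w : z != v -> Defs.arc (reverse_at [set v] alpha) z w -> Defs.arc alpha z w.
  move=> zv zw; move: (zw) (nv _ _ zw); rewrite /Defs.arc /= mem_reverse_at !inE.
  by move=> h /negPf wv; rewrite (negPf zv) wv in h.
apply/implyP => xy; apply/negP => /connectP[p yp def_x].
have yv := nv _ _ xy.
suff [xv yx] : x != v /\ connect (Defs.arc alpha) y x.
  have /forallP/(_ y)/implyP/(_ (arcE _ _ xv xy))/negP := acA x; exact.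
rewrite {}def_x {xy}; elim: p y yv yp => [|z p IHp] y yv //=.
move=> /andP[yz zp]; have [? zx] := IHp z (nv _ _ yz) zp; split=> //.
exact: connect_trans (connect1 (arcE _ _ yv yz)) zx.
Qed.

Lemma double_flip_sym : symmetric (@double_flip G).
Proof.
suff sub alpha beta : double_flip alpha beta -> double_flip beta alpha.
  by move=> alpha beta; apply/idP/idP; apply: sub.
move=> /existsP[u /existsP[v /and5P[/sourceP uS /sinkP vS uv euv /eqP defb]]].
apply/existsP; exists v; apply/existsP; exists u.
rewrite eq_sym uv edge_sym euv defb setUC reverse_atK eqxx !andbT.
apply/andP; split; [apply/sourceP | apply/sinkP] => w.
  by rewrite mem_reverse_at !inE eqxx /= orbT vS.
by rewrite mem_reverse_at !inE eqxx /= orbT uS.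
Qed.

Lemma double_flip_equiv_sym : connect_sym (@double_flip G).
Proof. exact: sym_connect_sym double_flip_sym. Qed.

(** Two distinct sinks are nonadjacent. After flipping [v], it is a source and [w] is still a sink;
    the double flip at this pair undoes the flip of [v] and flips [w]. *)
Lemma double_flip_sink_flips alpha gamma delta v w :
    sink alpha v -> sink alpha w ->
    arcs gamma = reverse_at [set v] alpha ->
    arcs delta = reverse_at [set w] alpha ->
  double_flip_equiv gamma delta.
Proof.
have [<- _ _ eqg eqd|vw vS wS eqg eqd] := eqVneq v w.
  have -> : gamma = delta by apply: val_inj; rewrite /= eqg.
  exact: connect0.
move/sinkP: vS => vS; move/sinkP: wS => wS.
apply: connect1; apply/existsP; exists v; apply/existsP; exists w.
apply/and5P; split => //.
- by apply/sourceP => z; rewrite eqg mem_reverse_at !inE eqxx orbT vS.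
- apply/sinkP => z; rewrite eqg mem_reverse_at !inE eq_sym (negPf vw) /=.
  by case: eqP => [->|_].
- by rewrite (acyc_edgeE alpha) negb_or vS wS.
apply/eqP; rewrite eqd eqg; apply/setP => -[x y].
rewrite !mem_reverse_at !inE.
by case: (eqVneq x v); case: (eqVneq y v); case: (eqVneq x w);
  case: (eqVneq y w) => * //=; subst; move: vw;
  rewrite ?eqxx ?(negPf (vS _)) ?(negPf (wS _)).
Qed.

(* If beta is the double flip of alpha at the source u and the sink z, then    *)
(* flipping the sink u of beta gives the same orientation as flipping the sink *)
(* z of alpha.                                                                 *)
Lemma sink_flip_congr alpha beta gamma delta v w :
    double_flip_equiv alpha beta ->
    sink alpha v -> sink beta w ->
    arcs gamma = reverse_at [set v] alpha ->
    arcs delta = reverse_at [set w] beta ->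
  double_flip_equiv gamma delta.
Proof.
move=> /connectP[p pth ->]; elim: p alpha pth gamma v => [|a p IHp] alpha /=.
  by move=> _ gamma v; apply: double_flip_sink_flips.
move=> /andP[/existsP[u /existsP[z]]].
move=> /and5P[/sourceP uS zS uz euz /eqP defa] pth gamma v vS wS eqg eqd.
pose eps := Acyc (acyc_sink_flip_subproof zS).
apply: (connect_trans (double_flip_sink_flips (delta := eps) vS zS eqg erefl)).
apply: (IHp a pth eps u) => //.
  by apply/sinkP => x; rewrite defa mem_reverse_at !inE eqxx uS.
move: euz; rewrite (acyc_edgeE alpha) negb_or => /andP[/negPf nuz /negPf nzu].
rewrite /= defa; apply/setP => -[x y]; rewrite !mem_reverse_at !inE.
by case: (eqVneq x u); case: (eqVneq y u); case: (eqVneq x z);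
  case: (eqVneq y z) => * //=; subst; move: uz;
  rewrite ?eqxx ?nuz ?nzu.
Qed.

End OrientationTheory.

(** * Toggles, the cyclic shift, and their effect on induced orientations *)

Section LabelingTheory.
Variable G : sgraph.
Implicit Types (sigma rho : labeling G) (i j : label G).

Lemma lab_invE sigma u : lab_inv sigma (sigma u) = u.
Proof. by apply: (@lab_inj _ sigma); rewrite lab_invK. Qed.

Lemma relabelE (s : {perm label G}) sigma u : relabel s sigma u = s (sigma u).
Proof. by rewrite /= ffunE. Qed.

Lemma labelingP sigma rho : sigma =1 rho -> sigma = rho.
Proof. by move=> eq_sr; apply: val_inj; apply/ffunP. Qed.

Lemma lab_inv_relabel (s : {perm label G}) sigma i :
  lab_inv (relabel s sigma) (s i) = lab_inv sigma i.
Proof. by apply: (@lab_inj _ (relabel s sigma)); rewrite lab_invK relabelE lab_invK. Qed.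

Lemma lab_inv_cyc sigma i : lab_inv (cyc sigma) (ordS i) = lab_inv sigma i.
Proof.
have -> : ordS i = long_cycle G i by rewrite permE.
exact: lab_inv_relabel.
Qed.

Lemma cyc_inj : injective (@cyc G).
Proof.
move=> sigma rho /(congr1 (fun f : labeling G => f : G -> label G)) eq_c.
apply: labelingP => u; apply: (@perm_inj _ (long_cycle G)).
by rewrite -!relabelE -/(cyc _) eq_c.
Qed.

Lemma tauK i : involutive (@tau G i).
Proof.
move=> sigma; rewrite {2}/tau /toggle; case: ifP => [e|ne].
  by rewrite /tau /toggle e.
set t := tperm i (ordS i).
have ti : lab_inv (relabel t sigma) i = lab_inv sigma (ordS i).
  by have := lab_inv_relabel t sigma (ordS i); rewrite tpermR.
have tj : lab_inv (relabel t sigma) (ordS i) = lab_inv sigma i.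
  by have := lab_inv_relabel t sigma i; rewrite tpermL.
rewrite /tau /toggle ti tj edge_sym ne.
by apply: labelingP => u; rewrite !relabelE tpermK.
Qed.

Lemma tau_cycE i sigma : tau (ordS i) (cyc sigma) = cyc (tau i sigma).
Proof.
rewrite /tau /toggle !lab_inv_cyc; case: ifP => // _.
have cE j : ordS j = long_cycle G j by rewrite permE.
apply: labelingP => u; rewrite /cyc !relabelE !cE inj_tperm //.
exact: perm_inj.
Qed.

Lemma tau_prodK s : cancel (@tau_prod G s) (tau_prod (rev s)).
Proof.
elim: s => [|i s IHs] sigma //.
by rewrite rev_cons /tau_prod foldr_rcons /= tauK; apply: IHs.
Qed.

Lemma induced_arcE sigma u v :
  ((u, v) \in arcs (induced sigma)) = edge u v && (sigma u < sigma v).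
Proof. by rewrite inE. Qed.

(** Topological sort: the number [f u] of vertices with a directed path to [u] strictly increases
    along arcs by acyclicity, so positions in a list sorted by [f] serve as labels. *)
Lemma induced_surj alpha : exists sigma, induced sigma = alpha.
Proof.
pose f u := #|[set w | connect (Defs.arc alpha) w u]|.
have f_lt u v : (u, v) \in arcs alpha -> f u < f v.
  move=> uv; apply/proper_card/properP; split.
    apply/subsetP => w; rewrite !inE => wu; exact: connect_trans wu (connect1 uv).
  exists v; rewrite inE ?connect0 //.
  by have /andP[_ /forallP/(_ u)/forallP/(_ v)/implyP/(_ uv)] := arcsP alpha.
pose s := sort (relpre f leq) (enum G).
have mem_s u : u \in s by rewrite mem_sort mem_enum.
have lt_s u : index u s < #|G| by rewrite cardE -(size_sort (relpre f leq)) index_mem.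
pose h := [ffun u => Ordinal (lt_s u)].
have h_inj : injective h.
  by move=> u v /(congr1 val); rewrite !ffunE /= => /index_inj; apply.
have h_lab : injectiveb h && [forall i, i \in codom h].
  apply/andP; split; first exact/injectiveP.
  by apply/forallP => i; apply: inj_card_onto; rewrite ?card_ord.
have h_lt u v : (u, v) \in arcs alpha -> h u < h v.
  move=> /f_lt; rewrite !ffunE /= !ltnNge; apply: contra => le_vu.
  have tot : total (relpre f leq) by move=> x y; apply: leq_total.
  have tr : transitive (relpre f leq) by move=> y x z; apply: leq_trans.
  have rf : reflexive (relpre f leq) by move=> x; apply: leqnn.
  by have := sorted_leq_index tr rf (sort_sorted tot (enum G)) v u (mem_s v) (mem_s u) le_vu.
exists (Labeling h_lab); apply: val_inj; apply/setP => -[u v].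
rewrite induced_arcE (acyc_edgeE alpha) /=.
case uv: ((u, v) \in _) => /=; first exact: h_lt.
by case vu: ((v, u) \in _) => //=; rewrite ltnNge ltnW // h_lt.
Qed.

(** Phrased with natural numbers so that [lia] can settle comparisons of toggled labels. *)
Lemma nat_of_tperm n (i j k : 'I_n) :
  tperm i j k = (if k == i :> nat then (j : nat)
                 else if k == j :> nat then (i : nat) else (k : nat)) :> nat.
Proof.
have valE (x y : 'I_n) : (x == y :> nat) = (x == y) by [].
rewrite !valE; case: tpermP => [->|->|/eqP/negPf-> /eqP/negPf->] //.
  by rewrite eqxx.
by case: eqP => [->|_]; rewrite ?eqxx.
Qed.

Lemma nonadjacent_labels sigma i j u v :
    edge (lab_inv sigma i) (lab_inv sigma j) = false -> edge u v ->
  ~ (sigma u = i :> nat /\ sigma v = j :> nat).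
Proof.
by move=> ne uv [/val_inj ui /val_inj vj]; rewrite -ui -vj !lab_invE uv in ne.
Qed.

(** Swapping consecutive labels changes the order of only the two vertices bearing them, which are
    nonadjacent when the toggle acts. *)
Lemma induced_tau_lt i sigma : i.+1 < #|G| -> induced (tau i sigma) = induced sigma.
Proof.
move=> lti; rewrite /tau /toggle; case: ifP => // ne.
apply: val_inj; apply/setP => -[u v]; rewrite !induced_arcE.
have [uv|//] := boolP (edge u v); rewrite !relabelE !nat_of_tperm.
have Si : ordS i = i.+1 :> nat by rewrite /= modn_small.
have := nonadjacent_labels ne uv; rewrite edge_sym in uv.
have := nonadjacent_labels ne uv; rewrite Si;
  do !case: eqP => ?; lia.
Qed.

(** The vertices with the smallest and largest labels are a source and a sink; exchanging these
    labels exchanges the roles and preserves all other comparisons. *)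
Lemma double_flip_tau_last i sigma : 1 < #|G| -> i.+1 = #|G| ->
  edge (lab_inv sigma i) (lab_inv sigma (ordS i)) = false ->
  double_flip (induced sigma) (induced (tau i sigma)).
Proof.
move=> lt1 defn ne; rewrite /tau /toggle ne.
set v := lab_inv sigma i; set u := lab_inv sigma (ordS i).
have Si : ordS i = 0 :> nat by rewrite /= defn modnn.
have i_gt0 : 0 < i by rewrite -ltnS defn.
have le_i w : sigma w <= i by rewrite -ltnS defn.
apply/existsP; exists u; apply/existsP; exists v; apply/and5P; split.
- by apply/sourceP => w; rewrite induced_arcE lab_invK Si ltn0 andbF.
- apply/sinkP => w; by rewrite induced_arcE lab_invK ltnNge le_i andbF.
- apply/eqP => /(congr1 sigma); rewrite !lab_invK => /(congr1 (@nat_of_ord _)).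
  by rewrite Si => i0; rewrite -i0 in i_gt0.
- by rewrite edge_sym ne.
apply/eqP/setP => -[x y]; rewrite mem_reverse_at !induced_arcE !inE.
have labE w i' : (w == lab_inv sigma i') = (sigma w == i' :> nat).
  by rewrite (val_eqE (sigma w)) -(inj_eq (@lab_inj _ sigma)) lab_invK.
rewrite /u /v !labE !relabelE !nat_of_tperm (edge_sym y x).
have [xy|_] := boolP (edge x y); last by rewrite if_same.
(* The edge is used in both directions: its ends bear the swapped labels in neither order. *)
have := nonadjacent_labels ne xy; rewrite edge_sym in xy.
have := nonadjacent_labels ne xy; have := le_i x; have := le_i y; rewrite {}Si.
move: (i : nat) (sigma x : nat) (sigma y : nat) i_gt0 => k a b;
  do !case: eqP => ? /=; lia.
Qed.

Lemma induced_tau i sigma : 1 < #|G| ->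
  double_flip_equiv (induced sigma) (induced (tau i sigma)).
Proof.
move=> lt1; have [lti|gei] := ltnP i.+1 #|G|.
  by rewrite induced_tau_lt //; apply: connect0.
have defn : i.+1 = #|G| by apply/eqP; rewrite eqn_leq gei ltn_ord.
have [e|ne] := boolP (edge (lab_inv sigma i) (lab_inv sigma (ordS i))).
  by rewrite /tau /toggle e; apply: connect0.
exact/connect1/double_flip_tau_last/negbTE.
Qed.

Lemma induced_tau_prod s sigma : 1 < #|G| ->
  double_flip_equiv (induced sigma) (induced (tau_prod s sigma)).
Proof.
move=> lt1; elim: s => [|i s IHs] /=; first exact: connect0.
exact: connect_trans IHs (induced_tau _ _ lt1).
Qed.

(** The shift preserves all comparisons except those with the largest label, which becomes the
    smallest: its vertex turns from sink to source. *)
Lemma induced_cyc sigma : 0 < #|G| ->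
  exists2 v, sink (induced sigma) v
    & arcs (induced (cyc sigma)) = reverse_at [set v] (induced sigma).
Proof.
move=> lt0; have lti : #|G|.-1 < #|G| by rewrite prednK.
pose i := Ordinal lti; have le_i w : sigma w <= i by rewrite -ltnS /= prednK.
exists (lab_inv sigma i).
  by apply/sinkP => w; rewrite induced_arcE lab_invK ltnNge le_i andbF.
apply/setP => -[x y]; rewrite mem_reverse_at !induced_arcE !inE.
have labE w : (w == lab_inv sigma i) = (sigma w == i :> nat).
  by rewrite (val_eqE (sigma w)) -(inj_eq (@lab_inj _ sigma)) lab_invK.
have cycE w : cyc sigma w = (if sigma w == i :> nat then 0 else (sigma w).+1) :> nat.
  rewrite relabelE permE [LHS]/=; case: eqP => [->|/eqP ne].
    by rewrite /= prednK // modnn.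
  by rewrite modn_small // (leq_trans (_ : _ < i.+1)) // ltnS ltn_neqAle ne le_i.
rewrite !labE !cycE (edge_sym y x).
have [xy|_] := boolP (edge x y); last by rewrite if_same.
have neq : sigma x <> sigma y :> nat.
  by move=> /val_inj/lab_inj exy; rewrite exy edge_irr in xy.
have := le_i x; have := le_i y; move: neq.
move: (i : nat) (sigma x : nat) (sigma y : nat) => k a b;
  do !case: eqP => ? /=; lia.
Qed.

Lemma tau_iter_cyc m i sigma :
  tau (iter m (@ordS #|G|) i) (iter m (@cyc G) sigma) = iter m (@cyc G) (tau i sigma).
Proof. by elim: m => //= m <-; rewrite tau_cycE. Qed.

Lemma val_iter_cyc m sigma u : val (iter m (@cyc G) sigma u) = (sigma u + m) %% #|G|.
Proof.
elim: m => [|m IHm]; first by rewrite addn0 modn_small.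
by rewrite iterS relabelE permE /= [X in X.+1]IHm -addn1 modnDml addn1 addnS.
Qed.

Lemma val_iter_ordS n m (i : 'I_n) : val (iter m (@ordS n) i) = (i + m) %% n.
Proof.
elim: m => [|m IHm]; first by rewrite addn0 modn_small.
by rewrite iterS /= [X in X.+1]IHm -addn1 modnDml addn1 addnS.
Qed.

Lemma iter_card_cyc sigma : iter #|G| (@cyc G) sigma = sigma.
Proof. by apply: labelingP => u; apply: val_inj; rewrite val_iter_cyc modnDr modn_small. Qed.

End LabelingTheory.

(** * Powers of psi and their action on double-flip classes *)

Section SinkStep.
Variables (G : sgraph) (lt1 : 1 < #|G|).
Implicit Types sigma rho : labeling G.

Definition sink_step sigma := tau (Ordinal (ltnW lt1)) (cyc sigma).
Local Notation psi := sink_step.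

Definition df_equiv_lab sigma rho := double_flip_equiv (induced sigma) (induced rho).
Local Notation "sigma =~ rho" := (df_equiv_lab sigma rho) (at level 70).

Lemma df_equiv_lab_sym sigma rho : (sigma =~ rho) = (rho =~ sigma).
Proof. exact: double_flip_equiv_sym. Qed.

Lemma df_equiv_lab_trans sigma rho pi : sigma =~ rho -> rho =~ pi -> sigma =~ pi.
Proof. exact: connect_trans. Qed.

(** Peel off the psi applied first: moving its tau_1 left across c^m turns it into tau_(m+1), the
    next factor of the product. *)
Lemma tau_cyc_iter m sigma : m <= #|G| -> tau_cyc m sigma = iter m psi sigma.
Proof.
elim: m sigma => [|m IHm] sigma ltm; first by rewrite /tau_cyc take0.
rewrite iterSr -IHm ?(ltnW ltm) // /tau_cyc -tau_iter_cyc.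
rewrite (take_nth (Ordinal (ltnW lt1))) ?size_enum_ord // /tau_prod foldr_rcons iterSr.
congr (foldr _ (tau _ _) _); apply: val_inj.
by rewrite val_iter_ordS /= nth_enum_ord // ?add0n modn_small.
Qed.

Lemma iter_card_sink_step sigma : iter #|G| psi sigma = tau_prod (enum (label G)) sigma.
Proof.
by rewrite -tau_cyc_iter // /tau_cyc iter_card_cyc take_oversize // size_enum_ord.
Qed.

Lemma sink_step_inj : injective psi.
Proof. by move=> sigma rho /(can_inj (tauK _)) /cyc_inj. Qed.

Lemma iter_sink_step_inj m : injective (iter m psi).
Proof. by elim: m => //= m IHm sigma rho /sink_step_inj /IHm. Qed.

Lemma iter_card_sink_stepK : cancel (iter #|G| psi) (@TPro G).
Proof. by move=> sigma; rewrite iter_card_sink_step; apply: tau_prodK. Qed.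

Lemma TPro_sink_stepK : cancel (@TPro G) (iter #|G| psi).
Proof.
by move=> sigma; rewrite iter_card_sink_step -{1}[enum _]revK; apply: tau_prodK.
Qed.

Lemma iter_sink_step_TPro m sigma : iter m psi (TPro sigma) = TPro (iter m psi sigma).
Proof.
rewrite -[LHS]iter_card_sink_stepK -iterD addnC iterD.
by rewrite TPro_sink_stepK.
Qed.

(** The shift performs the flip; the toggle that follows stays in the double-flip class. *)
Lemma sink_step_flip sigma :
  exists2 v, sink (induced sigma) v &
  exists2 gamma : acyc G, arcs gamma = reverse_at [set v] (induced sigma)
                        & double_flip_equiv gamma (induced (psi sigma)).
Proof.
have [v vS def_c] := induced_cyc sigma (ltnW lt1).
by exists v => //; exists (induced (cyc sigma)); rewrite ?induced_tau.
Qed.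

Lemma sink_step_sink_flip sigma rho v :
    sink (induced sigma) v ->
    arcs (induced rho) = reverse_at [set v] (induced sigma) ->
  psi sigma =~ rho.
Proof.
move=> vS def_r; have [w wS [gamma def_g gS]] := sink_step_flip sigma.
rewrite df_equiv_lab_sym; apply: connect_trans gS.
exact: double_flip_sink_flips vS wS def_r def_g.
Qed.

Lemma sink_step_congr sigma rho : sigma =~ rho -> psi sigma =~ psi rho.
Proof.
have [v vS [gamma def_g gS]] := sink_step_flip sigma.
have [w wS [delta def_d dS]] := sink_step_flip rho.
move=> eq_sr; have gd := sink_flip_congr eq_sr vS wS def_g def_d.
apply: connect_trans (connect_trans gd dS).
by rewrite double_flip_equiv_sym.
Qed.

Lemma iter_sink_step_congr m sigma rho :
  sigma =~ rho -> iter m psi sigma =~ iter m psi rho.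
Proof. by move=> sr; elim: m => //= m; apply: sink_step_congr. Qed.

Lemma iter_mul_card_sink_step k sigma : iter (k * #|G|) psi sigma =~ sigma.
Proof.
elim: k => [|k IHk]; first exact: connect0.
rewrite mulSn iterD; apply: df_equiv_lab_trans IHk.
by rewrite df_equiv_lab_sym iter_card_sink_step; apply: induced_tau_prod.
Qed.

(** On classes psi^(kn) is the identity, so psi^(kn-k) inverts psi^k; the subtraction is exact
    because n is positive. *)
Lemma iter_sink_step_sym k sigma rho : iter k psi sigma =~ rho ->
  iter (k * #|G| - k) psi rho =~ sigma.
Proof.
rewrite df_equiv_lab_sym => /(iter_sink_step_congr (k * #|G| - k)).
rewrite -iterD subnK; last by rewrite leq_pmulr // ltnW.
move=> h; exact: df_equiv_lab_trans h (iter_mul_card_sink_step k sigma).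
Qed.

Lemma iter_sink_step_trans k l sigma rho pi :
  iter k psi sigma =~ rho -> iter l psi rho =~ pi -> iter (l + k) psi sigma =~ pi.
Proof.
by move=> /(iter_sink_step_congr l); rewrite -iterD; apply: df_equiv_lab_trans.
Qed.

Lemma sink_step_flip_equiv sigma rho : flip_equiv (induced sigma) (induced rho) ->
  exists k, iter k psi sigma =~ rho.
Proof.
move=> /connectP[p]; elim: p sigma => [|beta p IHp] sigma /=.
  by move=> _ def_r; exists 0; rewrite /= /df_equiv_lab def_r; apply: connect0.
move=> /andP[/existsP[u /andP[uSS /eqP def_b]] pth def_r].
(* Realise the intermediate orientation by a labeling, so that psi can act on it. *)
have [pi def_pi] := induced_surj beta; rewrite -{beta}def_pi in def_b pth def_r.
have [l pi_r] := IHp _ pth def_r.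
suff [k s_pi] : exists k, iter k psi sigma =~ pi.
  by exists (l + k); apply: iter_sink_step_trans s_pi pi_r.
have [uSr|uSk] := orP uSS; last first.
  by exists 1; apply: sink_step_sink_flip uSk def_b.
(* A source flip is the inverse of a sink flip, and n-1 steps invert one step on classes. *)
exists (1 * #|G| - 1); apply: iter_sink_step_sym.
apply: (@sink_step_sink_flip _ _ u); last by rewrite def_b reverse_atK.
by apply/sinkP => w; rewrite def_b mem_reverse_at !in_set1 eqxx (sourceP _ _ uSr).
Qed.

Lemma sink_step_flip_class sigma rho pi :
    flip_equiv (induced pi) (induced sigma) ->
    flip_equiv (induced pi) (induced rho) ->
  exists2 m, m < #|G| & iter m psi sigma =~ rho.
Proof.
move=> /sink_step_flip_equiv[k ps] /sink_step_flip_equiv[l pr].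
have := iter_sink_step_trans (iter_sink_step_sym ps) pr; set j := l + _ => sr.
(* The exponent [j] leads from [sigma] back to [pi] and on to [rho]; multiples of n act trivially on
   classes. *)
exists (j %% #|G|); first by rewrite ltn_mod ltnW.
apply: df_equiv_lab_trans sr; rewrite {2}(divn_eq j #|G|) addnC iterD.
by apply: iter_sink_step_congr; rewrite df_equiv_lab_sym iter_mul_card_sink_step.
Qed.

End SinkStep.

Theorem theorem2p6 (G : sgraph) (hn : 2 <= #|G|)
    (C D D' : {set acyc G})
    (hC : C \in flip_classes G)
    (hD : D \in double_flip_classes G) (hD' : D' \in double_flip_classes G)
    (hDC : D \subset C) (hD'C : D' \subset C) :
  exists m : nat,
    [/\ m <= #|G| - 1,
        {in lin_ext D &, injective (@tau_cyc G m)},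
        @tau_cyc G m @: lin_ext D = lin_ext D'
      & {in lin_ext D, forall sigma,
           tau_cyc m (TPro sigma) = TPro (tau_cyc m sigma)}].
Proof.
have /imsetP[alpha _ defD] := hD; have /imsetP[beta _ defD'] := hD'.
have /imsetP[gamma _ defC] := hC.
have memD delta : (delta \in D) = double_flip_equiv alpha delta.
  by rewrite defD !inE.
have memD' delta : (delta \in D') = double_flip_equiv beta delta.
  by rewrite defD' !inE.
have := subsetP hDC alpha; rewrite memD /double_flip_equiv connect0 defC !inE => /(_ isT) gA.
have := subsetP hD'C beta; rewrite memD' /double_flip_equiv connect0 defC !inE => /(_ isT) gB.
have [sigma defs] := induced_surj alpha; have [rho defr] := induced_surj beta.
have [pi defp] := induced_surj gamma.
rewrite -{}defp -{}defs -{}defr in memD memD' gA gB.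
have [m ltm sr] := sink_step_flip_class hn gA gB.
have m_iter pi' : tau_cyc m pi' = iter m (sink_step hn) pi'.
  by rewrite tau_cyc_iter // ltnW.
(* The inverse power of psi on classes injects L(D') into L(D), so surjectivity will follow from
   injectivity by counting. *)
have le_card : #|lin_ext D'| <= #|lin_ext D|.
  have rs := iter_sink_step_sym sr.
  rewrite -(card_imset _ (@iter_sink_step_inj _ hn (m * #|G| - m))).
  apply/subset_leq_card/subsetP => _ /imsetP[pi' + ->].
  rewrite !inE memD memD' -!/(df_equiv_lab _ _) => /(iter_sink_step_congr hn _).
  move=> /(_ (m * #|G| - m)); apply: df_equiv_lab_trans.
  by rewrite df_equiv_lab_sym.
have tau_inj : injective (@tau_cyc G m).
  by move=> x y; rewrite !m_iter => /iter_sink_step_inj.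
exists m; split.
- by rewrite -ltnS subn1 prednK // ltnW.
- by move=> x y _ _ /tau_inj.
- apply/eqP; rewrite eqEcard card_imset // le_card andbT.
  apply/subsetP => _ /imsetP[pi' + ->].
  rewrite !inE memD memD' m_iter -!/(df_equiv_lab _ _).
  move=> /(iter_sink_step_congr hn m); apply: df_equiv_lab_trans.
  by rewrite df_equiv_lab_sym.
by move=> pi' _; rewrite !m_iter iter_sink_step_TPro.
Qed.
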